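(* Let $p$ be a prime, let $a\in\mathbb{Q}_p$ with $|a|_p=1$, and let $f(x)=x^3+ax^2$ on $\mathbb{Q}_p$. Then the fixed point $x_1=0$ of $f$ is an attractor and $$A(x_1)=B_1(0)\cup D\big[S_1(0),B_1(-a)\big].$$
   Context: $|\cdot|_p$ is the $p$-adic norm on $\mathbb{Q}_p$. For $c\in\mathbb{Q}_p$, $r>0$: $B_r(c)=\{x\in\mathbb{Q}_p:|x-c|_p<r\}$, $S_r(c)=\{x\in\mathbb{Q}_p:|x-c|_p=r\}$. $f^{(n)}$ denotes the $n$-fold iterate of $f$ ($f^{(0)}=\mathrm{id}$). A fixed point $x^{(0)}$ of $f$ is an attractor if it has a neighborhood $U$ such that $f^{(n)}(y)\to x^{(0)}$ for all $y\in U$; its basin of attraction is $A(x^{(0)})=\{y\in\mathbb{Q}_p: f^{(n)}(y)\to x^{(0)},\ n\to\infty\}$. For sets $A,B\subset\mathbb{Q}_p$, $D[A,B]=\{x\in A:\ \text{there is an integer } k\ge 0 \text{ with } f^{(k)}(x)\in B\}$. *)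

(* Defs.v *)
From HB Require Import structures.
From mathcomp Require Import all_boot all_order all_algebra.
From mathcomp Require Import generic_quotient ring_quotient.
From mathcomp Require Import zify ring lra.
From mathcomp Require Import boolp classical_sets functions filter topology.

Set Implicit Arguments.
Unset Strict Implicit.
Unset Printing Implicit Defensive.

Import Order.TTheory GRing.Theory Num.Theory.
Import numFieldTopology.Exports.

Local Open Scope classical_set_scope.
Local Open Scope ring_scope.

(** The absolute value [p ^ (- v_p x)].  Every value is 0 or an integral power of
    p, so a rational codomain loses nothing; the same holds for [padic_norm]. *)
Definition padic_normq (p : nat) (x : rat) : rat :=
  if x == 0 then 0
  else p%:R ^ ((logn p `|denq x|)%:Z - (logn p `|numq x|)%:Z).

Section PadicNormq.
Variables (p : nat) (p_pr : prime p).
Local Notation N := (padic_normq p).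

Let p_gt0 : 0 < p%:R :> rat. Proof. by rewrite ltr0n prime_gt0. Qed.
Let p_gt1 : 1 < p%:R :> rat. Proof. by rewrite ltr1n prime_gt1. Qed.

Lemma padic_normq_frac (n d : int) : n != 0 -> d != 0 ->
  N (n%:~R / d%:~R) = p%:R ^ ((logn p `|d|)%:Z - (logn p `|n|)%:Z).
Proof.
move=> n0 d0; rewrite /padic_normq; set x := _ / _.
have dQ : d%:~R != 0 :> rat by rewrite intr_eq0.
have xn0 : x != 0 by rewrite mulf_neq0 ?invr_eq0 ?intr_eq0.
rewrite (negPf xn0).
have E : numq x * d = n * denq x.
  apply: (@intr_inj rat); rewrite !rmorphM /= numqE mulrAC; congr (_ * _).
  by rewrite /x divfK.
have /(congr1 (logn p)) := congr1 absz E.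
rewrite !abszM !lognM ?absz_gt0 ?numq_eq0 ?denq_neq0 //.
move: (logn _ _) (logn _ _) (logn _ _) (logn _ _) => i j k l ijkl.
by congr (_ ^ _); lia.
Qed.

Lemma padic_normq0 : N 0 = 0. Proof. by rewrite /padic_normq eqxx. Qed.

Lemma padic_normq_gt0 x : x != 0 -> 0 < N x.
Proof. by move=> x0; rewrite /padic_normq (negPf x0) exprz_gt0. Qed.

Lemma padic_normq_ge0 x : 0 <= N x.
Proof.
by case: (eqVneq x 0) => [->|/padic_normq_gt0/ltW //]; rewrite padic_normq0.
Qed.

Lemma padic_normq_eq0 x : (N x == 0) = (x == 0).
Proof.
case: (eqVneq x 0) => [->|x0]; first by rewrite padic_normq0 eqxx.
by rewrite gt_eqF ?padic_normq_gt0.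
Qed.

Lemma padic_normqM x y : N (x * y) = N x * N y.
Proof.
case: (eqVneq x 0) => [->|x0]; first by rewrite mul0r padic_normq0 mul0r.
case: (eqVneq y 0) => [->|y0]; first by rewrite mulr0 padic_normq0 mulr0.
rewrite -(divq_num_den x) -(divq_num_den y) mulf_div -!rmorphM /=.
rewrite !padic_normq_frac ?mulf_neq0 ?denq_neq0 ?numq_eq0 //.
rewrite -expfzDr ?gt_eqF // !abszM !lognM ?absz_gt0 ?denq_neq0 ?numq_eq0 //.
move: (logn _ _) (logn _ _) (logn _ _) (logn _ _) => i j k l.
by congr (_ ^ _); lia.
Qed.

Lemma padic_normq1 : N 1 = 1.
Proof.
have /mulIf := lt0r_neq0 (padic_normq_gt0 (oner_neq0 rat)).
by apply; rewrite -padic_normqM !mul1r.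
Qed.

Lemma padic_normqN x : N (- x) = N x.
Proof. by rewrite /padic_normq oppr_eq0 numqN denqN abszN. Qed.

Lemma padic_normqBC x y : N (x - y) = N (y - x).
Proof. by rewrite -opprB padic_normqN. Qed.

Lemma padic_normqV x : N x^-1 = (N x)^-1.
Proof.
case: (eqVneq x 0) => [->|x0]; first by rewrite !(invr0, padic_normq0).
apply: (mulIf (lt0r_neq0 (padic_normq_gt0 x0))).
by rewrite -padic_normqM !mulVf ?padic_normq1 // padic_normq_eq0.
Qed.

Lemma padic_normqD_max x y : N (x + y) <= Num.max (N x) (N y).
Proof.
case: (eqVneq x 0) => [->|x0]; first by rewrite add0r le_max lexx orbT.
case: (eqVneq y 0) => [->|y0]; first by rewrite addr0 le_max lexx.
case: (eqVneq (x + y) 0) => [->|xy0].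
  by rewrite padic_normq0 le_max padic_normq_ge0.
pose a := numq x * denq y; pose b := numq y * denq x.
pose d := denq x * denq y.
have d0 : d != 0 by rewrite mulf_neq0 ?denq_neq0.
have dx : (denq x)%:~R != 0 :> rat by rewrite intr_eq0 denq_neq0.
have dy : (denq y)%:~R != 0 :> rat by rewrite intr_eq0 denq_neq0.
have xE : x = a%:~R / d%:~R.
  by rewrite /a /d !rmorphM /= numqE; field; rewrite dx dy.
have yE : y = b%:~R / d%:~R.
  by rewrite /b /d !rmorphM /= numqE; field; rewrite dx dy.
have a0 : a != 0 by rewrite mulf_neq0 ?denq_neq0 ?numq_eq0.
have b0 : b != 0 by rewrite mulf_neq0 ?denq_neq0 ?numq_eq0.
have xyE : x + y = (a + b)%:~R / d%:~R by rewrite xE yE -mulrDl -rmorphD.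
have ab0 : a + b != 0.
  by apply: contraNneq xy0; rewrite xyE => ->; rewrite mul0r.
rewrite xyE xE yE !padic_normq_frac // le_max !ler_eXz2l //.
suff : (logn p `|a| <= logn p `|(a + b)%R|)%N
       || (logn p `|b| <= logn p `|(a + b)%R|)%N by lia.
rewrite -geq_min -pfactor_dvdn ?absz_gt0 //.
have -> : (p ^ minn (logn p `|a|) (logn p `|b|) %| `|(a + b)%R|)%N
        = ((p ^ minn (logn p `|a|) (logn p `|b|))%:Z %| (a + b))%Z by [].
by apply: rpredD; rewrite /dvdz unfold_in /= pfactor_dvdn ?absz_gt0 // ?geq_minl ?geq_minr.
Qed.

Lemma padic_normqB_max x y : N (x - y) <= Num.max (N x) (N y).
Proof. by rewrite -(padic_normqN y) padic_normqD_max. Qed.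

Lemma padic_normq_eq x y : N (x - y) < N y -> N x = N y.
Proof.
move=> h; have h1 := padic_normqD_max (x - y) y.
have h2 := padic_normqD_max (y - x) x; rewrite padic_normqBC in h2.
rewrite !subrK in h1 h2.
move: h1 h2; rewrite !le_max => /orP[|] h1 /orP[|] h2; lra.
Qed.

Lemma padic_normqB_lt x y e : N x < e -> N y < e -> N (x - y) < e.
Proof.
by move=> xe ye; apply: (le_lt_trans (padic_normqB_max x y)); rewrite gt_max xe.
Qed.

Lemma padic_normqD_lt x y e : N x < e -> N y < e -> N (x + y) < e.
Proof.
by move=> xe ye; apply: (le_lt_trans (padic_normqD_max x y)); rewrite gt_max xe.
Qed.

Definition padic_cauchy : pred (nat -> rat) := fun u =>
  `[< forall e : rat, 0 < e -> exists n0 : nat,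
      forall m n : nat, (n0 <= m)%N -> (n0 <= n)%N -> N (u m - u n) < e >].

Lemma padic_cauchyP u : reflect
  (forall e : rat, 0 < e -> exists n0 : nat,
     forall m n : nat, (n0 <= m)%N -> (n0 <= n)%N -> N (u m - u n) < e)
  (padic_cauchy u).
Proof. exact: asboolP. Qed.

Lemma padic_cauchy_bounded u : padic_cauchy u ->
  exists2 M : rat, 0 < M & exists n0 : nat,
    forall n, (n0 <= n)%N -> N (u n) < M.
Proof.
move=> /padic_cauchyP/(_ 1 ltr01)[n0 h].
exists (N (u n0) + 1); first by rewrite ltr_wpDl ?padic_normq_ge0.
exists n0 => n nn0; rewrite -(subrK (u n0) (u n)); apply: padic_normqD_lt.
  by apply: lt_le_trans (h _ _ nn0 (leqnn _)) _; rewrite lerDr padic_normq_ge0.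
by rewrite ltrDl.
Qed.

Lemma padic_cauchy_subring : subring_closed padic_cauchy.
Proof.
split.
- apply/padic_cauchyP => e e0; exists 0%N => m n _ _.
  by rewrite subrr padic_normq0.
- move=> u v /padic_cauchyP cu /padic_cauchyP cv; apply/padic_cauchyP => e e0.
  have [n1 h1] := cu e e0; have [n2 h2] := cv e e0.
  exists (maxn n1 n2) => m n; rewrite !geq_max => /andP[m1 m2] /andP[n1' n2'].
  have -> : (u - v) m - (u - v) n = (u m - u n) - (v m - v n).
    by rewrite !fctE; ring.
  by apply: padic_normqB_lt; [exact: h1|exact: h2].
- move=> u v cu cv; apply/padic_cauchyP => e e0.
  have [A A0 [a hA]] := padic_cauchy_bounded cu.
  have [B B0 [b hB]] := padic_cauchy_bounded cv.
  move/padic_cauchyP: cu => /(_ (e / B))[|n1 h1]; first by rewrite divr_gt0.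
  move/padic_cauchyP: cv => /(_ (e / A))[|n2 h2]; first by rewrite divr_gt0.
  exists (maxn (maxn a b) (maxn n1 n2)) => m n.
  rewrite !geq_max => /andP[/andP[ma mb] /andP[m1 m2]].
  move=> /andP[/andP[na nb] /andP[nn1 nn2]].
  have -> : (u * v) m - (u * v) n = u m * (v m - v n) + (u m - u n) * v n.
    by rewrite !fctE; ring.
  apply: padic_normqD_lt; rewrite padic_normqM.
    rewrite -[e](divfK (lt0r_neq0 A0)) mulrC.
    apply: ltr_pM; rewrite ?padic_normq_ge0 //; [exact: h2|exact: hA].
  rewrite -[e](divfK (lt0r_neq0 B0)).
  apply: ltr_pM; rewrite ?padic_normq_ge0 //; [exact: h1|exact: hB].
Qed.

End PadicNormq.

Record cauchy_seq (p : nat) (p_pr : prime p) := CauchySeq {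
  cauchy_seq_val :> nat -> rat;
  _ : padic_cauchy p cauchy_seq_val
}.

Section CauchySeq.
Variables (p : nat) (p_pr : prime p).
Local Notation N := (padic_normq p).
Local Notation C := (cauchy_seq p_pr).

#[local] HB.instance Definition _ := GRing.isSubringClosed.Build (nat -> rat)
  (padic_cauchy p) (padic_cauchy_subring p_pr).
HB.instance Definition _ := [isSub for @cauchy_seq_val p p_pr].
HB.instance Definition _ := [Choice of C by <:].
HB.instance Definition _ := [SubChoice_isSubComNzRing of C by <:].

Lemma cauchy_seqP (u : C) : padic_cauchy p u. Proof. exact: (valP u). Qed.

Definition null_seq : pred C := fun u =>
  `[< forall e : rat, 0 < e -> exists n0 : nat,
      forall n : nat, (n0 <= n)%N -> N (u n) < e >].

Lemma null_seqP (u : C) : reflect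
  (forall e : rat, 0 < e -> exists n0 : nat,
     forall n : nat, (n0 <= n)%N -> N (u n) < e)
  (null_seq u).
Proof. exact: asboolP. Qed.

Lemma null_seq_idealr : idealr_closed null_seq.
Proof.
split.
- apply/null_seqP => e e0; exists 0%N => n _.
  by rewrite [X in N X](_ : _ = 0) // padic_normq0.
- apply/negP => /null_seqP/(_ 1 ltr01)[n0 /(_ n0 (leqnn _))].
  by rewrite [X in N X](_ : _ = 1) // padic_normq1 ?ltxx.
move=> c u v /null_seqP nu /null_seqP nv; apply/null_seqP => e e0.
have [M M0 [n1 h1]] := padic_cauchy_bounded p_pr (cauchy_seqP c).
have [n2 h2] := nu (e / M) (divr_gt0 e0 M0).
have [n3 h3] := nv e e0.
exists (maxn n1 (maxn n2 n3)) => n; rewrite !geq_max => /and3P[nn1 nn2 nn3].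
rewrite [X in N X](_ : _ = c n * u n + v n) //.
apply: padic_normqD_lt => //; last exact: h3.
rewrite padic_normqM // -[e](divfK (lt0r_neq0 M0)) mulrC.
by apply: ltr_pM; rewrite ?padic_normq_ge0 //; [exact: h2|exact: h1].
Qed.

HB.instance Definition _ := isIdealr.Build C null_seq null_seq_idealr.

Lemma null_seqPn (u : C) : ~~ null_seq u ->
  exists2 r : rat, 0 < r & exists n0 : nat,
    forall n, (n0 <= n)%N -> N (u n) = r.
Proof.
move=> /null_seqP; move/existsNP => [e /not_implyP[e0 /forallNP h]].
have [n0 c] := elimT (padic_cauchyP p u) (cauchy_seqP u) e e0.
have /existsNP[n /not_implyP[n0n /negP]] := h n0.
rewrite -leNgt => eu.
exists (N (u n)); first exact: lt_le_trans eu.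
exists n0 => m n0m; apply: padic_normq_eq => //.
exact: lt_le_trans (c m n n0m n0n) eu.
Qed.

Definition inv_seq (u : C) : nat -> rat := fun n => (u n)^-1.

Lemma inv_seq_cauchy (u : C) : ~~ null_seq u -> padic_cauchy p (inv_seq u).
Proof.
move=> /null_seqPn[r r0 [n0 ur]]; apply/padic_cauchyP => e e0.
have er0 : 0 < e * (r * r) by rewrite !mulr_gt0.
have [n1 h] := elimT (padic_cauchyP p u) (cauchy_seqP u) _ er0.
exists (maxn n0 n1) => m n; rewrite !geq_max => /andP[m0 m1] /andP[nn0 nn1].
have um : u m != 0 by rewrite -(padic_normq_eq0 p_pr) ur // gt_eqF.
have un : u n != 0 by rewrite -(padic_normq_eq0 p_pr) ur // gt_eqF.
have -> : inv_seq u m - inv_seq u n = (u n - u m) * (u m * u n)^-1.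
  by rewrite /inv_seq; field; rewrite um un.
rewrite !(padic_normqM p_pr, padic_normqV p_pr) !ur //.
by rewrite ltr_pdivrMr ?mulr_gt0 // h.
Qed.

End CauchySeq.

(** [Qp p_pr] is the completion of the rationals for the p-adic absolute value,
    built as Cauchy sequences modulo null sequences.  Its topology is the one of
    the [isMetric] instance below, with distance [padic_norm (x - y)]. *)

Definition Qp (p : nat) (p_pr : prime p) : Type :=
  {ideal_quot (@null_seq p p_pr : idealr (cauchy_seq p_pr))}.

Section Qp.
Variables (p : nat) (p_pr : prime p).
Local Notation N := (padic_normq p).
Local Notation Qp := (Qp p_pr).
Local Notation C := (cauchy_seq p_pr).

HB.instance Definition _ := GRing.ComNzRing.on Qp.
HB.instance Definition _ := EqQuotient.on Qp.

Definition Qp_of (u : C) : Qp := \pi_Qp%qT u.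

(** The limit exists: the sequence is eventually constant or tends to 0. *)
Definition padic_norm (x : Qp) : rat :=
  lim ((N (repr x n) : rat^o) @[n --> \oo]).

Lemma Qp_of_eq (u v : C) : (Qp_of u == Qp_of v) = null_seq (u - v).
Proof. by rewrite -Quotient.idealrBE. Qed.

Lemma Qp_reprK (x : Qp) : Qp_of (repr x) = x.
Proof. exact: reprK. Qed.

Lemma Qp_ofB (u v : C) : Qp_of (u - v) = Qp_of u - Qp_of v.
Proof. exact: (raddfB (\pi_Qp%qT)). Qed.

Lemma Qp_ofM (u v : C) : Qp_of (u * v) = Qp_of u * Qp_of v.
Proof. exact: (rmorphM (\pi_Qp%qT)). Qed.

Lemma Qp_of1 : Qp_of 1 = 1.
Proof. exact: (rmorph1 (\pi_Qp%qT)). Qed.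

Lemma Qp_of0 : Qp_of 0 = 0.
Proof. exact: (rmorph0 (\pi_Qp%qT)). Qed.

Lemma Qp_of_eq0 (u : C) : (Qp_of u == 0) = null_seq u.
Proof. by rewrite -Qp_of0 Qp_of_eq subr0. Qed.

Lemma Qp_inv_ex (x : Qp) : x != 0 -> exists y, y * x = 1.
Proof.
rewrite -(Qp_reprK x); move: (repr x) => u; rewrite Qp_of_eq0 => un0.
exists (Qp_of (CauchySeq p_pr (inv_seq_cauchy un0))).
rewrite -Qp_ofM -Qp_of1; apply/eqP; rewrite Qp_of_eq.
have [r r0 [n0 h]] := null_seqPn un0.
apply/null_seqP => e e0; exists n0 => n n0n.
rewrite [X in N X](_ : _ = (u n)^-1 * u n - 1) //.
have u0 : u n != 0 by rewrite -(padic_normq_eq0 p_pr) h // gt_eqF.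
by rewrite mulVf // subrr padic_normq0.
Qed.

Definition Qp_inv (x : Qp) : Qp := xget 0 [set y | y * x = 1].

Lemma Qp_mulVf (x : Qp) : x != 0 -> Qp_inv x * x = 1.
Proof.
by move=> /Qp_inv_ex[y yx]; rewrite /Qp_inv; case: xgetP => [z _ //|/(_ y)].
Qed.

Lemma Qp_invr0 : Qp_inv 0 = 0.
Proof.
rewrite /Qp_inv; case: xgetP => // y _ /= /eqP.
by rewrite mulr0 eq_sym oner_eq0.
Qed.

HB.instance Definition _ := GRing.ComNzRing_isField.Build Qp Qp_mulVf Qp_invr0.

Lemma padic_norm_of (u : C) r : 0 < r ->
  (exists n0 : nat, forall n, (n0 <= n)%N -> N (u n) = r) ->
  padic_norm (Qp_of u) = r.
Proof.
move=> r0 [n0 h]; rewrite /padic_norm; apply: (@lim_near_cst rat^o).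
  exact: metric_hausdorff.
have : null_seq (repr (Qp_of u) - u) by rewrite -Qp_of_eq Qp_reprK.
move=> /null_seqP/(_ r r0)[n1 h1].
near=> n.
rewrite -(h n); last by near: n; exists n0.
apply: (padic_normq_eq p_pr); rewrite h; last by near: n; exists n0.
by apply: h1; near: n; exists n1.
Unshelve. all: by end_near. Qed.

Lemma padic_norm0 : padic_norm 0 = 0.
Proof.
have : null_seq (repr (0 : Qp)) by rewrite -Qp_of_eq0 Qp_reprK.
move=> /null_seqP h; apply: (@cvg_lim rat^o); first exact: metric_hausdorff.
apply/cvg_ballP => e e0; have [n0 h0] := h e e0; exists n0 => // n n0n.
rewrite ballEmdist /= /mdist /= subr0 ger0_norm ?h0 //.
exact: padic_normq_ge0.
Qed.

(** Nonzero elements: the norm is the eventual value along any representative. *)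
Lemma padic_norm_ofE (u : C) : Qp_of u != 0 ->
  0 < padic_norm (Qp_of u) /\
  exists n0 : nat, forall n, (n0 <= n)%N -> N (u n) = padic_norm (Qp_of u).
Proof.
rewrite Qp_of_eq0 => /null_seqPn[r r0 h].
by rewrite (padic_norm_of r0 h).
Qed.

Lemma padic_norm_gt0 (x : Qp) : x != 0 -> 0 < padic_norm x.
Proof. by rewrite -(Qp_reprK x) => /padic_norm_ofE[]. Qed.

Lemma padic_norm_ge0 (x : Qp) : 0 <= padic_norm x.
Proof.
by case: (eqVneq x 0) => [->|/padic_norm_gt0/ltW //]; rewrite padic_norm0.
Qed.

Lemma padic_norm_eq0 (x : Qp) : (padic_norm x == 0) = (x == 0).
Proof.
case: (eqVneq x 0) => [->|x0]; first by rewrite padic_norm0 eqxx.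
by rewrite gt_eqF ?padic_norm_gt0.
Qed.

Lemma padic_normM (x y : Qp) : padic_norm (x * y) = padic_norm x * padic_norm y.
Proof.
case: (eqVneq x 0) => [->|]; first by rewrite mul0r padic_norm0 mul0r.
case: (eqVneq y 0) => [->|]; first by rewrite mulr0 padic_norm0 mulr0.
rewrite -(Qp_reprK x) -(Qp_reprK y); move: (repr x) (repr y) => u v.
move=> /padic_norm_ofE[v0 [n1 h1]] /padic_norm_ofE[u0 [n2 h2]].
rewrite -Qp_ofM; apply: padic_norm_of; first exact: mulr_gt0.
exists (maxn n1 n2) => n; rewrite geq_max => /andP[nn1 nn2].
by rewrite [X in N X](_ : _ = u n * v n) // (padic_normqM p_pr) h1 ?h2.
Qed.

Lemma padic_normB_max (x y : Qp) :
  padic_norm (x - y) <= Num.max (padic_norm x) (padic_norm y).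
Proof.
have NN z : padic_norm (- z) = padic_norm z.
  case: (eqVneq z 0) => [->|]; first by rewrite oppr0.
  rewrite -(Qp_reprK z); move: (repr z) => u /padic_norm_ofE[u0 [n0 h]].
  rewrite -[- _]add0r -Qp_of0 -Qp_ofB; apply: padic_norm_of => //.
  exists n0 => n n0n; rewrite [X in N X](_ : _ = 0 - u n) //.
  by rewrite sub0r padic_normqN // h.
case: (eqVneq x 0) => [->|]; first by rewrite sub0r NN le_max lexx orbT.
case: (eqVneq y 0) => [->|]; first by rewrite subr0 le_max lexx.
case: (eqVneq (x - y) 0) => [->|].
  by rewrite padic_norm0 le_max padic_norm_ge0.
rewrite -(Qp_reprK x) -(Qp_reprK y); move: (repr x) (repr y) => u v.
rewrite -Qp_ofB => /padic_norm_ofE[_ [n0 h0]].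
move=> /padic_norm_ofE[_ [n1 h1]] /padic_norm_ofE[_ [n2 h2]].
pose n := maxn n0 (maxn n1 n2).
rewrite -(h0 n) -?(h1 n) -?(h2 n) ?leq_max ?leqnn ?orbT //.
exact: padic_normqB_max.
Qed.

Lemma padic_normN (x : Qp) : padic_norm (- x) = padic_norm x.
Proof.
have le z : padic_norm (- z) <= padic_norm z.
  have := padic_normB_max 0 z; rewrite sub0r padic_norm0.
  by rewrite le_max => /orP[|//] /le_trans; apply; exact: padic_norm_ge0.
by apply/eqP; rewrite eq_le le -{1}(opprK x) le.
Qed.

Lemma padic_normD_max (x y : Qp) :
  padic_norm (x + y) <= Num.max (padic_norm x) (padic_norm y).
Proof. by rewrite -(padic_normN y) -{1}(opprK y) padic_normB_max. Qed.

Let dist (x y : Qp) : rat := padic_norm (x - y).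

Let distxx x : dist x x = 0.
Proof. by rewrite /dist subrr padic_norm0. Qed.

Let dist_positivity x y : dist x y = 0 -> x = y.
Proof. by move/eqP; rewrite padic_norm_eq0 subr_eq0 => /eqP. Qed.

Let dist_sym x y : dist x y = dist y x.
Proof. by rewrite /dist -opprB padic_normN. Qed.

Let dist_triangle y x z : dist x z <= dist x y + dist y z.
Proof.
rewrite /dist -(subrKA y); apply: (le_trans (padic_normD_max _ _)).
by rewrite ge_max lerDl lerDr !padic_norm_ge0.
Qed.

HB.instance Definition _ :=
  isMetric.Build rat Qp distxx dist_positivity dist_sym dist_triangle.

Definition padic_ball (c : Qp) (r : rat) : set Qp :=
  [set x | padic_norm (x - c) < r].

Definition padic_sphere (c : Qp) (r : rat) : set Qp :=
  [set x | padic_norm (x - c) = r].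

End Qp.

Section Dynamics.
Variables (T : topologicalType) (f : T -> T).

Definition attractor (x0 : T) : Prop :=
  f x0 = x0 /\
  exists2 U : set T, nbhs x0 U &
    forall y, U y -> iter n f y @[n --> \oo] --> x0.

Definition basin (x0 : T) : set T :=
  [set y | iter n f y @[n --> \oo] --> x0].

(** The set written D[A, B]. *)
Definition hitting (A B : set T) : set T :=
  [set x | A x /\ exists k : nat, B (iter k f x)].

End Dynamics.

(* Main.v *)
Require Import Defs.
From mathcomp Require Import all_boot all_order all_algebra.
From mathcomp Require Import boolp classical_sets topology.
From mathcomp Require Import sequences.

Import GRing.Theory.
Import Order.TTheory Num.Theory.
Local Open Scope classical_set_scope.
Local Open Scope ring_scope.

Set Implicit Arguments.
Unset Strict Implicit.

(** Write [f x = x ^+ 2 * (x + a)].  Since the absolute value is multiplicative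
    and [|a| = 1], everything follows from [|f x| = |x|^2 |x + a|] and the
    ultrametric inequality, according to the position of [x]:
    - if [|x| < 1] then [|x + a| = 1], so [|f x| = |x|^2] and the orbit converges
      to 0 at least geometrically ([iter_cubic_cvg0]); hence 0 is an attractor,
      and a point is in the basin as soon as its orbit enters the unit ball;
    - if [|x| = 1] then [|f x| = |x + a|], so [f x] enters the unit ball exactly
      when [x] lies in the unit ball around [- a], and otherwise stays on the
      sphere;
    - if [|x| > 1] then [|x + a| = |x|], so [|f x| = |x|^3 > 1] and the orbit never
      meets the unit ball.
    Thus an orbit that converges to 0 from outside the unit ball starts on the
    sphere, and its last point there lies in the ball around [- a]. *)

Section PadicNorm.
Variables (p : nat) (p_pr : prime p).
Implicit Types x y : Qp p_pr.

(** The isosceles triangle principle. *)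
Lemma padic_normD_eqr x y :
  padic_norm x < padic_norm y -> padic_norm (x + y) = padic_norm y.
Proof.
move=> xy; apply/eqP; rewrite eq_le; apply/andP; split.
  by have := padic_normD_max x y; rewrite (max_r (ltW xy)).
have := padic_normB_max (x + y) x; rewrite addrC addKr le_max => /orP[//|].
by rewrite leNgt xy.
Qed.

Lemma padic_cvg0P (u : nat -> Qp p_pr) :
  u n @[n --> \oo] --> (0 : Qp p_pr) <->
  forall e : rat, 0 < e -> \forall n \near \oo, padic_norm (u n) < e.
Proof.
have E e n : ball (0 : Qp p_pr) e (u n) = (padic_norm (u n) < e).
  by rewrite ballEmdist /= /mdist /= sub0r padic_normN.
by rewrite cvg_ballP; split=> h e /h; apply: filterS => n; rewrite E.
Qed.

End PadicNorm.

Section Cubic.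
Variables (p : nat) (p_pr : prime p) (a : Qp p_pr).
Hypothesis norm_a : padic_norm a = 1.

Local Notation f := (fun x : Qp p_pr => x ^+ 3 + a * x ^+ 2).

Lemma padic_norm_cubic x :
  padic_norm (f x) = padic_norm x ^+ 2 * padic_norm (x + a).
Proof.
by rewrite /= exprS -mulrDl padic_normM mulrC !expr2 padic_normM.
Qed.

(** Near 0 the factor [x + a] has norm 1. *)
Lemma padic_norm_cubic_ball x :
  padic_norm x < 1 -> padic_norm (f x) = padic_norm x ^+ 2.
Proof.
by move=> x1; rewrite padic_norm_cubic padic_normD_eqr ?norm_a // mulr1.
Qed.

Lemma padic_norm_cubic_sphere x :
  padic_norm x = 1 -> padic_norm (f x) = padic_norm (x + a).
Proof. by move=> x1; rewrite padic_norm_cubic x1 expr1n mul1r. Qed.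

Lemma padic_norm_cubic_gt1 x : 1 < padic_norm x -> 1 < padic_norm (f x).
Proof.
move=> x1; rewrite padic_norm_cubic addrC padic_normD_eqr ?norm_a //.
by rewrite -exprSr exprn_egt1.
Qed.

(** The true decay is [padic_norm x ^+ (2 ^ n)]; a geometric bound suffices for
    convergence. *)
Lemma padic_norm_iter_cubic x n :
  padic_norm x < 1 -> padic_norm (iter n f x) <= padic_norm x ^+ n.+1.
Proof.
move=> x1; elim: n => [|n IHn]; first by rewrite expr1.
have xn1 : padic_norm (iter n f x) <= padic_norm x.
  by apply: le_trans IHn _; rewrite exprS ler_piMr ?padic_norm_ge0 //
    exprn_ile1 ?padic_norm_ge0 // ltW.
rewrite iterS padic_norm_cubic_ball ?(le_lt_trans xn1) // expr2 exprS.
by rewrite ler_pM ?padic_norm_ge0.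
Qed.

Lemma iter_cubic_cvg0 x :
  padic_norm x < 1 -> iter n f x @[n --> \oo] --> (0 : Qp p_pr).
Proof.
move=> x1; apply/padic_cvg0P => e e0.
have /cvg_expr xX : `|padic_norm x| < 1 by rewrite ger0_norm ?padic_norm_ge0.
have := @cvg_ball _ rat^o _ _ eventually_filter _ _ xX e e0.
apply: filterS => n /=; rewrite ballEmdist /= /mdist /= subr0.
rewrite ger0_norm ?exprn_ge0 ?padic_norm_ge0 //; apply: le_lt_trans.
apply: le_trans (padic_norm_iter_cubic n x1) _.
by rewrite exprSr ler_piMr ?exprn_ge0 ?padic_norm_ge0 // ltW.
Qed.

(** The open unit ball is a neighbourhood of 0 whose points are all attracted by
    0, so membership in the basin is decided by entering it. *)
Lemma basin_cubicE x :
  basin f 0 x <-> exists k, padic_norm (iter k f x) < 1.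
Proof.
split=> [/padic_cvg0P/(_ 1 ltr01)[k _ /(_ k (leqnn k))]|[k xk]]; first by exists k.
apply/padic_cvg0P => e e0.
have /padic_cvg0P/(_ e e0)[m _ hm] := iter_cubic_cvg0 xk.
exists (m + k)%N => // n /= mkn.
have kn : (k <= n)%N := leq_trans (leq_addl m k) mkn.
by rewrite -(subnK kn) iterD; apply: hm; rewrite /= leq_subRL // addnC.
Qed.

(** An orbit starting beyond the unit sphere stays there by
    [padic_norm_cubic_gt1], and one starting on the sphere leaves it only through
    the unit ball around [- a]. *)
Lemma cubic_enters_ball x k :
  padic_norm (iter k f x) < 1 ->
  padic_norm x < 1 \/
  padic_norm x = 1 /\ exists j, padic_norm (iter j f x + a) < 1.
Proof.
elim: k x => [|k IHk] x; first by left.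
rewrite iterSr => /IHk fx.
case: (ltgtP (padic_norm x) 1) => [|x1|x1]; first by left.
  by case: fx => [|[]]; have := padic_norm_cubic_gt1 x1;
    [move=> /lt_trans h /h|move=> + E; rewrite E]; rewrite ltxx.
right; split=> //; case: fx => [|[_ [j xj]]].
  by rewrite padic_norm_cubic_sphere //; exists 0.
by exists j.+1; rewrite iterSr.
Qed.

End Cubic.

Unset Implicit Arguments.
Set Strict Implicit.

Theorem theorem5p7 (p : nat) (p_pr : prime p) (a : Qp p_pr)
  (ha : padic_norm a = 1) :
  let f := fun x : Qp p_pr => x ^+ 3 + a * x ^+ 2 in
  attractor f 0 /\
  basin f 0 =
    padic_ball 0 1 `|` hitting f (padic_sphere 0 1) (padic_ball (- a) 1).
Proof.
move=> f; split.
  split; first by rewrite /f !expr0n /= mulr0 addr0.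
  exists (ball (0 : Qp p_pr) 1); first exact: nbhsx_ballx.
  move=> y; rewrite ballEmdist /= /mdist /= sub0r padic_normN.
  exact: iter_cubic_cvg0.
apply/seteqP; rewrite /padic_ball /hitting /padic_sphere /=; split=> x /=.
  move=> /(basin_cubicE ha)[k /(cubic_enters_ball ha)].
  rewrite subr0 => -[x1|[x1 [j xj]]]; [by left|right].
  by split=> //; exists j; rewrite opprK.
rewrite subr0 => hx; apply: (basin_cubicE ha x).2.
case: hx => [x1|[_ [k]]]; first by exists 0%N.
rewrite opprK => xk; exists k.+1.
(* By the isosceles principle, the unit ball around - a lies on the sphere. *)
have xk1 : padic_norm (iter k f x) = 1.
  have := @padic_normD_eqr p p_pr (iter k f x + a) (- a).
  by rewrite padic_normN ha addrK; apply.
by rewrite iterS padic_norm_cubic_sphere.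
Qed.
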